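(* Let $k$ be a field of characteristic zero, let $n\ge 2$, and let $0\ne f\in S=k[x_1,\ldots,x_n]$. Consider the map $$\pi:\mathcal{Z}(I_f)\to \mathrm{Derlog}_S(f),\qquad (a_0,a_1,\ldots,a_n)\mapsto \sum_{i=1}^n a_i\frac{\partial}{\partial x_i},$$ and let $\bar\pi:\mathcal{Z}(I_f)\to\mathcal{E}_f$ be the composite of $\pi$ with the quotient map $\mathrm{Derlog}_S(f)\to\mathcal{E}_f$. Then: (i) $\pi$ is an isomorphism of $S$-modules. (ii) $\bar\pi$ induces an isomorphism of $S$-modules $\mathcal{H}(I_f)\simeq\mathcal{E}_f$.
   Context: Write $f_i=\partial f/\partial x_i$ and $I_f=\langle f,f_1,\ldots,f_n\rangle\subset S$. Consider the Koszul complex over $S$ of the sequence $f,f_1,\ldots,f_n$. $\mathcal{Z}(I_f)\subseteq S^{n+1}$ denotes its module of first cycles, i.e. the first syzygy module $\{(a_0,\ldots,a_n)\in S^{n+1} : a_0f+a_1f_1+\cdots+a_nf_n=0\}$; $\mathcal{B}(I_f)\subseteq\mathcal{Z}(I_f)$ denotes its module of first boundaries; and $\mathcal{H}(I_f)=\mathcal{Z}(I_f)/\mathcal{B}(I_f)$ is the first Koszul homology module. $\mathrm{Der}_k(S)$ is the module of $k$-derivations of $S$, free on $\partial/\partial x_1,\ldots,\partial/\partial x_n$. The module of logarithmic derivations is $\mathrm{Derlog}_S(f)=\{\eta\in\mathrm{Der}_k(S) : \eta(f)\in fS\}$. The Koszul derivations are the elements $$\left\{ f_i\frac{\partial}{\partial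 x_j}-f_j\frac{\partial}{\partial x_i} : 1\le i,j\le n\right\}\cup\left\{ f\frac{\partial}{\partial x_i} : 1\le i\le n\right\}$$ of $\mathrm{Derlog}_S(f)$. The module of essential derivations $\mathcal{E}_f$ is the quotient of $\mathrm{Derlog}_S(f)$ by the $S$-submodule generated by the Koszul derivations. *)

(* Defs.v *)
From HB Require Import structures.
From mathcomp Require Import all_boot all_order all_algebra.
From mathcomp Require Import boolp functions mpoly.

Set Implicit Arguments.
Unset Strict Implicit.
Unset Printing Implicit Defensive.

Import GRing.Theory.
Local Open Scope ring_scope.
Local Open Scope quotient_scope.

Section Modules.
Variables (R : comNzRingType) (V : lmodType R).
Implicit Types P N : submodClosed V.

Record submod P := Submod { submod_val : V; _ : submod_val \in P }.

HB.instance Definition _ P := [isSub for @submod_val P].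
HB.instance Definition _ P := [Choice of submod P by <:].
HB.instance Definition _ P := [SubChoice_isSubLmodule of submod P by <:].

(* The library's submodClosed does not inherit from zmodClosed, which the
   quotient construction requires. *)
Definition zmod_pred N : {pred V} := fun x => x \in N.

Lemma zmod_pred_closed N : zmod_closed (zmod_pred N).
Proof. exact/GRing.submod_closedB/submodClosedP. Qed.

HB.instance Definition _ N :=
  GRing.isZmodClosed.Build V (zmod_pred N) (zmod_pred_closed N).

Definition quotmod N : Type := Quotient.quot (zmod_pred N).

HB.instance Definition _ N := GRing.Zmodule.on (quotmod N).

Definition quot_map N (x : V) : quotmod N := \pi_(Quotient.quot (zmod_pred N)) x.

Definition quot_scale N (a : R) (x : quotmod N) : quotmod N :=
  quot_map N (a *: repr (x : Quotient.quot (zmod_pred N))).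

Lemma quot_mapP N x y : reflect (quot_map N x = quot_map N y) (x - y \in N).
Proof.
rewrite -[_ \in N]/(_ \in zmod_pred N) Quotient.idealrBE; exact: eqP.
Qed.

Lemma quot_mapK N (x : quotmod N) :
  quot_map N (repr (x : Quotient.quot (zmod_pred N))) = x.
Proof. exact: reprK. Qed.

Lemma quot_mapD N x y : quot_map N (x + y) = quot_map N x + quot_map N y.
Proof. exact: raddfD. Qed.

Lemma quot_scaleE N a x : quot_scale a (quot_map N x) = quot_map N (a *: x).
Proof.
by apply/quot_mapP; rewrite -scalerBr rpredZ //; apply/quot_mapP/quot_mapK.
Qed.

Lemma quot_scaleA N a b x :
  @quot_scale N a (quot_scale b x) = quot_scale (a * b) x.
Proof. by rewrite -[x]quot_mapK !quot_scaleE scalerA. Qed.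

Lemma quot_scale1 N : left_id 1 (@quot_scale N).
Proof. by move=> x; rewrite -[x]quot_mapK quot_scaleE scale1r. Qed.

Lemma quot_scaleDr N : right_distributive (@quot_scale N) +%R.
Proof.
move=> a x y; rewrite -[x]quot_mapK -[y]quot_mapK.
by rewrite -quot_mapD !quot_scaleE scalerDr quot_mapD.
Qed.

Lemma quot_scaleDl N x : {morph (@quot_scale N)^~ x : a b / a + b}.
Proof.
move=> a b; rewrite /= -[x]quot_mapK !quot_scaleE scalerDl.
exact: quot_mapD.
Qed.

HB.instance Definition _ N :=
  GRing.Zmodule_isLmodule.Build R (quotmod N)
    (@quot_scaleA N) (@quot_scale1 N) (@quot_scaleDr N) (@quot_scaleDl N).

Definition span_pred (A : V -> Prop) : {pred V} := fun x =>
  `[< exists s : seq (R * V),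
        (forall p, p \in s -> A p.2) /\ x = \sum_(p <- s) p.1 *: p.2 >].

Lemma span_submod A : submod_closed (span_pred A).
Proof.
split=> [|a x y /asboolP[s [sA ->]] /asboolP[t [tA ->]]]; apply/asboolP.
  by exists [::]; rewrite big_nil.
exists ([seq (a * p.1, p.2) | p <- s] ++ t); split=> [p|].
  by rewrite mem_cat => /orP[/mapP[q /sA Aq ->]|/tA].
rewrite big_cat big_map scaler_sumr; congr (_ + _).
by apply: eq_bigr => p _; rewrite scalerA.
Qed.

HB.instance Definition _ A :=
  GRing.isSubmodClosed.Build R V (span_pred A) (span_submod A).

End Modules.

Section Subquotients.
Variables (R : comNzRingType) (V : lmodType R).
Implicit Types P N : submodClosed V.

Definition restr_pred P N : {pred submod P} := fun x => val x \in N.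

Lemma restr_submod P N : submod_closed (@restr_pred P N).
Proof.
have restrE x : (x \in @restr_pred P N) = (val x \in N) by [].
split=> [|a x y]; rewrite !restrE; first by rewrite raddf0 rpred0.
by move=> xN yN; rewrite linearP rpredD ?rpredZ.
Qed.

HB.instance Definition _ P N :=
  GRing.isSubmodClosed.Build R (submod P) (@restr_pred P N) (restr_submod P N).

(* This is P / (P :&: N), hence P / N when N is contained in P; see
   boundaries1_cycles1 and span_koszul_der_derlog for the instances below. *)
Definition subquot P N : lmodType R := quotmod (@restr_pred P N).

End Subquotients.

Definition module_iso (R : comNzRingType) (U V : lmodType R) (h : U -> V) :=
  linear h /\ bijective h.

Section Koszul.
Variables (R : comNzRingType) (m : nat) (g : 'I_m -> R).

Definition koszul_d1 (a : 'rV[R]_m) : R := \sum_(i < m) a 0 i * g i.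

(* An element of the second exterior power is given by the coefficients c i j
   of e_i /\ e_j for i < j (the other entries of c are ignored), and
   e_i /\ e_j is sent to g_i e_j - g_j e_i. *)
Definition koszul_d2 (c : 'M[R]_m) : 'rV[R]_m :=
  \sum_(i < m) \sum_(j < m | (i < j)%N)
     c i j *: (g i *: delta_mx 0 j - g j *: delta_mx 0 i).

Definition cycles1 : {pred 'rV[R]_m} := fun a => koszul_d1 a == 0.

Definition boundaries1 : {pred 'rV[R]_m} :=
  fun a => `[< exists c, a = koszul_d2 c >].

Lemma koszul_d1_is_linear : linear_for *%R koszul_d1.
Proof.
move=> c a b; rewrite /koszul_d1 mulr_sumr -big_split.
by apply: eq_bigr => i _; rewrite !mxE mulrDl mulrA.
Qed.

HB.instance Definition _ :=
  GRing.isLinear.Build R 'rV[R]_m R *%R koszul_d1 koszul_d1_is_linear.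

Lemma koszul_d2_is_linear : linear koszul_d2.
Proof.
move=> c a b; rewrite /koszul_d2 scaler_sumr -big_split.
apply: eq_bigr => i _; rewrite scaler_sumr -big_split.
by apply: eq_bigr => j _; rewrite !mxE scalerDl scalerA.
Qed.

HB.instance Definition _ :=
  GRing.isLinear.Build R 'M[R]_m 'rV[R]_m *:%R koszul_d2 koszul_d2_is_linear.

Lemma cycles1_submod : submod_closed cycles1.
Proof.
split=> [|c a b]; rewrite !unfold_in ?linear0 // => /eqP a0 /eqP b0.
by rewrite linearP /= a0 b0 mulr0 addr0.
Qed.

Lemma boundaries1_submod : submod_closed boundaries1.
Proof.
split=> [|c a b /asboolP[u ->] /asboolP[v ->]]; apply/asboolP.
  by exists 0; rewrite linear0.
by exists (c *: u + v); rewrite linearP.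
Qed.

HB.instance Definition _ :=
  GRing.isSubmodClosed.Build R 'rV[R]_m cycles1 cycles1_submod.
HB.instance Definition _ :=
  GRing.isSubmodClosed.Build R 'rV[R]_m boundaries1 boundaries1_submod.

Lemma koszul_d1_delta j : koszul_d1 (delta_mx 0 j) = g j.
Proof.
rewrite /koszul_d1 (bigD1 j) //= big1 => [|i /negPf ij].
  by rewrite mxE !eqxx mul1r addr0.
by rewrite mxE ij andbF mul0r.
Qed.

Lemma boundaries1_cycles1 : {subset boundaries1 <= cycles1}.
Proof.
move=> _ /asboolP[c ->]; apply/eqP; rewrite linear_sum big1 // => i _.
rewrite linear_sum big1 // => j _.
rewrite linearZ_LR linearB !linearZ_LR /= !koszul_d1_delta.
by rewrite [g j * _]mulrC subrr mulr0.
Qed.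

Definition koszul_H1 : lmodType R := subquot cycles1 boundaries1.

End Koszul.

Section Derivations.
Variables (k : fieldType) (n : nat).
Local Notation S := {mpoly k[n]}.

Definition is_derivation (D : S -> S) : Prop :=
  linear D /\ forall g h, D (g * h) = D g * h + g * D h.

(* The codomain S^o (S as a module over itself) makes S -> S^o an S-module,
   with (h *: D) g = h * D g. *)
Definition der_pred : {pred S -> S^o} := fun D => `[< is_derivation D >].

Lemma der_submod : submod_closed der_pred.
Proof.
split=> [|a D E /asboolP[Dl DM] /asboolP[El EM]]; apply/asboolP; split.
- by move=> c g h; change (0 = c *: 0 + 0 :> S); rewrite scaler0 addr0.
- by move=> g h; change (0 = 0 * h + g * 0 :> S); rewrite mul0r mulr0 addr0.
- move=> c g h /=.
  change (a * D (c *: g + h) + E (c *: g + h) =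
    c *: (a * D g + E g) + (a * D h + E h)).
  by rewrite Dl El mulrDr scalerDr -scalerAr addrACA.
- move=> g h.
  change (a * D (g * h) + E (g * h) =
    (a * D g + E g) * h + g * (a * D h + E h)).
  rewrite DM EM !mulrDr !mulrDl !mulrA [g * a]mulrC.
  by rewrite addrACA.
Qed.

HB.instance Definition _ :=
  GRing.isSubmodClosed.Build S (S -> S^o) der_pred der_submod.

Definition Der : lmodType S := submod der_pred.

Definition der_fun (D : Der) : S -> S := submod_val D.

Lemma mderiv_der (i : 'I_n) : (mderiv i : S -> S^o) \in der_pred.
Proof.
by apply/asboolP; split=> [c g h|g h]; rewrite ?linearP // mderivM.
Qed.

Definition partial (i : 'I_n) : Der := Submod (mderiv_der i).

Lemma der_funP (c : S) (D E : Der) g :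
  der_fun (c *: D + E) g = c * der_fun D g + der_fun E g.
Proof. by []. Qed.

Variable f : S.

Definition derlog_pred : {pred Der} :=
  fun D => `[< exists h, der_fun D f = f * h >].

Lemma derlog_submod : submod_closed derlog_pred.
Proof.
split=> [|c D E /asboolP[g Dg] /asboolP[h Eh]]; apply/asboolP.
  by exists 0; rewrite mulr0.
by exists (c * g + h); rewrite der_funP Dg Eh mulrDr mulrCA.
Qed.

HB.instance Definition _ :=
  GRing.isSubmodClosed.Build S Der derlog_pred derlog_submod.

Definition Derlog : lmodType S := submod derlog_pred.

Definition koszul_der (D : Der) : Prop :=
  (exists i j, D = f^`M(i) *: partial j - f^`M(j) *: partial i) \/
  (exists i, D = f *: partial i).

Lemma koszul_der_derlog D : koszul_der D -> D \in derlog_pred.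
Proof.
case=> [[i [j ->]]|[i ->]]; apply/asboolP.
  exists 0; rewrite mulr0.
  change (f^`M(i) * f^`M(j) - f^`M(j) * f^`M(i) = 0).
  by rewrite mulrC subrr.
by exists (f^`M(i)).
Qed.

Lemma span_koszul_der_derlog : {subset span_pred koszul_der <= derlog_pred}.
Proof.
move=> _ /asboolP[s [sK ->]]; rewrite big_seq rpred_sum // => p ps.
by apply/rpredZ/koszul_der_derlog/sK.
Qed.

Definition essential_der : lmodType S :=
  subquot derlog_pred (span_pred koszul_der).

(* The sequence f, f_1, ..., f_n. *)
Definition jacobian_seq (i : 'I_n.+1) : S :=
  if unlift ord0 i is Some j then f^`M(j) else f.

Definition Zf : lmodType S := submod (cycles1 jacobian_seq).
Definition Hf : lmodType S := koszul_H1 jacobian_seq.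

Definition class_H : Zf -> Hf := quot_map _.
Definition class_E : Derlog -> essential_der := quot_map _.

Definition row_der (a : 'rV[S]_n.+1) : Der :=
  \sum_(i < n) a 0 (lift ord0 i) *: partial i.

Lemma row_derE a g :
  der_fun (row_der a) g = \sum_(i < n) a 0 (lift ord0 i) * g^`M(i).
Proof.
rewrite /row_der; elim/big_rec2: _ => [//|i y D _ <-].
exact: (der_funP _ (partial i)).
Qed.

Lemma row_der_derlog (z : Zf) : row_der (val z) \in derlog_pred.
Proof.
case: z => a /= az; apply/asboolP; exists (- a 0 ord0).
move: az; rewrite unfold_in /koszul_d1 big_ord_recl /jacobian_seq unlift_none.
rewrite row_derE addrC addr_eq0 => /eqP; rewrite mulrN mulrC => <-.
by apply: eq_bigr => i _; rewrite liftK.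
Qed.

Definition pi_map (z : Zf) : Derlog := Submod (row_der_derlog z).

Definition pi_bar (z : Zf) : essential_der := class_E (pi_map z).

End Derivations.

(* Main.v *)
(* A derivation of S is determined by its values on the variables, so D is the
   sum of D(x_i) d/dx_i; as f is a nonzerodivisor, a logarithmic D determines
   the coefficient a_0 = - D(f) / f, whence (i).  For (ii), pi sends the Koszul
   boundaries g_i e_j - g_j e_i to Koszul derivations, and every Koszul
   derivation arises this way; hence pi identifies the boundaries with the span
   of the Koszul derivations. *)
From HB Require Import structures.
Require Import Defs.
From mathcomp Require Import all_boot all_order all_algebra.
From mathcomp Require Import mpoly.
From mathcomp Require Import boolp.

Import GRing.Theory.
Local Open Scope ring_scope.

Lemma inj_surj_bij (A B : Type) (h : A -> B) :
  injective h -> (forall b, exists a, h a = b) -> bijective h.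
Proof.
move=> h_inj /choice[g gK]; exists g => // a.
exact/h_inj/gK.
Qed.

(** As [M] is exactly the preimage of [N], one implication makes the induced map well defined and
    the other makes it injective. *)
Lemma quot_module_iso (R : comNzRingType) (U V : lmodType R)
    (M : submodClosed U) (N : submodClosed V) (h : U -> V) :
    module_iso h -> (forall x, (h x \in N) = (x \in M)) ->
  exists phi : quotmod M -> quotmod N,
    (forall x, phi (quot_map M x) = quot_map N (h x)) /\ module_iso phi.
Proof.
move=> [h_lin [h' h'K hK]] hMN.
have hB x y : h (x - y) = h x - h y.
  by rewrite addrC -scaleN1r h_lin scaleN1r addrC.
(* Defined through chosen representatives; [phiE] shows that the choice is immaterial. *)
pose phi (x : quotmod M) := quot_map N (h (repr x)).
have phiE x : phi (quot_map M x) = quot_map N (h x).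
  apply/quot_mapP; rewrite -hB hMN; apply/quot_mapP; exact: quot_mapK.
exists phi; split=> //; split=> [a x y|].
  rewrite -[x]quot_mapK -[y]quot_mapK -[a *: _]/(quot_scale _ _).
  rewrite quot_scaleE -quot_mapD !phiE h_lin quot_mapD.
  by rewrite -[a *: quot_map _ _]/(quot_scale _ _) quot_scaleE.
apply: inj_surj_bij => [x y|y].
  rewrite -[x]quot_mapK -[y]quot_mapK !phiE => /quot_mapP.
  by rewrite -hB hMN => /quot_mapP.
by exists (quot_map M (h' (repr y))); rewrite phiE hK quot_mapK.
Qed.

Lemma mem_span (R : comNzRingType) (V : lmodType R) (A : V -> Prop) x :
  A x -> x \in span_pred A.
Proof.
move=> Ax; apply/asboolP; exists [:: (1, x)]; split=> [p|].
  by rewrite inE => /eqP->.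
by rewrite big_seq1 scale1r.
Qed.

Lemma koszul_boundary (R : comNzRingType) m (g : 'I_m -> R) i j :
  g i *: delta_mx 0 j - g j *: delta_mx 0 i \in boundaries1 g.
Proof.
(* [koszul_d2] sums over [i < j] only: swapping the indices changes the sign, and equal indices give
   0. *)
wlog ltij : i j / (i < j)%N => [IH|].
  have [/IH//|/IH ij|/val_inj->] := ltngtP i j; last by rewrite subrr rpred0.
  by rewrite -opprB -scaleN1r rpredZ.
apply/asboolP; exists (delta_mx i j); rewrite /koszul_d2.
rewrite (bigD1 i) //= [X in _ = _ + X]big1 ?addr0 => [|i' /negPf ii'].
  rewrite (bigD1 j) //= big1 ?addr0 => [|j' /andP[_ /negPf jj']].
    by rewrite mxE !eqxx scale1r.
  by rewrite mxE jj' andbF scale0r.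
by rewrite big1 // => j' _; rewrite mxE ii' scale0r.
Qed.

Section LogarithmicDerivations.
Variables (k : fieldType) (n : nat).
Local Notation S := {mpoly k[n]}.

Lemma der_eq (D E : Der k n) : der_fun D =1 der_fun E -> D = E.
Proof. by move=> DE; apply/val_inj/funext. Qed.

(** The difference [F] of the two derivations kills the variables, hence all monomials by the
    Leibniz rule, hence all polynomials by linearity over [k]. *)
Lemma der_fun_ext (D E : Der k n) :
  (forall i, der_fun D 'X_i = der_fun E 'X_i) -> D = E.
Proof.
move=> DE; pose F := (-1) *: E + D.
have FE g : der_fun F g = der_fun D g - der_fun E g.
  by rewrite der_funP mulN1r addrC.
have F0 i : der_fun F 'X_i = 0 by rewrite FE DE subrr.
suff Fz g : der_fun F g = 0.
  by apply: der_eq => g; apply/eqP; rewrite -subr_eq0 -FE Fz.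
have /asboolP[Flin FM] : der_fun F \in @der_pred k n by case: (F).
have F1 : der_fun F 1 = 0.
  (* The Leibniz rule on [1 * 1] gives F(1) = F(1) + F(1). *)
  apply: (addrI (der_fun F 1)); rewrite addr0.
  by rewrite -[RHS]/(der_fun F 1) -[in RHS](mulr1 1) FM mulr1 mul1r.
have FMz p q : der_fun F p = 0 -> der_fun F q = 0 -> der_fun F (p * q) = 0.
  by move=> Fp Fq; rewrite FM Fp Fq mul0r mulr0 addr0.
have Fm m : der_fun F 'X_[m] = 0.
  rewrite mpolyXE_id; elim/big_ind: _ => // i _.
  by elim: (m i) => [//|e IH]; rewrite exprS FMz.
elim/mpolyind: g => [|c m p _ _ IH]; last first.
  by rewrite Flin Fm IH scaler0 addr0.
by rewrite -[X in der_fun F X](mulr0 0) FM mulr0 mul0r addr0.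
Qed.

Lemma row_der_linear : linear (@row_der k n).
Proof.
move=> a x y; rewrite /row_der scaler_sumr -big_split.
by apply: eq_bigr => i _; rewrite !mxE scalerDl scalerA.
Qed.

HB.instance Definition _ :=
  GRing.isLinear.Build S 'rV[S]_n.+1 (Der k n) *:%R (@row_der k n)
    row_der_linear.

Lemma row_derZB a b (x y : 'rV[S]_n.+1) :
  row_der (a *: x - b *: y) = a *: row_der x - b *: row_der y.
Proof. by rewrite linearB; congr (_ - _); apply: linearZ. Qed.

Lemma row_derX (a : 'rV[S]_n.+1) i :
  der_fun (row_der a) 'X_i = a 0 (lift ord0 i).
Proof.
rewrite row_derE (bigD1 i) //= big1 ?addr0 => [|j ji].
  rewrite mderivX mnm1E eqxx scale1r; have -> : (U_(i) - U_(i) = 0)%MM.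
    by apply/mnmP => j; rewrite mnmBE subnn mnm0E.
  by rewrite mpolyX0 mulr1.
by rewrite mderivX mnm1E eq_sym (negPf ji) scale0r mulr0.
Qed.

Lemma row_der_delta0 : row_der (delta_mx 0 ord0) = 0 :> Der k n.
Proof.
by rewrite /row_der big1 // => i _; rewrite mxE /= scale0r.
Qed.

Lemma row_der_delta (i : 'I_n) :
  row_der (delta_mx 0 (lift ord0 i)) = partial k i.
Proof.
rewrite /row_der (bigD1 i) //= big1 ?addr0 => [|j ji].
  by rewrite mxE !eqxx scale1r.
by rewrite mxE (inj_eq (lift_inj (h := ord0))) (negPf ji) andbF scale0r.
Qed.

Variable f : S.
Hypothesis f_neq0 : f != 0.
Local Notation g := (jacobian_seq f).

(** Splitting off the entry at [ord0] turns the syzygy relation into a condition on D(f), where D is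
    [row_der a]. *)
Lemma cycles1_jacobianE (a : 'rV[S]_n.+1) :
  (a \in cycles1 g) = (a 0 ord0 * f + der_fun (row_der a) f == 0).
Proof.
rewrite unfold_in /koszul_d1 big_ord_recl /jacobian_seq unlift_none row_derE.
congr (_ + _ == 0); by apply: eq_bigr => i _; rewrite liftK.
Qed.

(** [row_der] forgets the entry at [ord0]. On cycles the relation fixes that entry times [f], and
    [f] cancels in a domain; the other entries are the values on the variables. *)
Lemma row_der_inj : {in cycles1 g &, injective (@row_der k n)}.
Proof.
move=> a b; rewrite !cycles1_jacobianE => /eqP a0 /eqP b0 ab.
apply/rowP => i; case: (unliftP ord0 i) => [j|] ->.
  by rewrite -!row_derX ab.
apply: (mulIf f_neq0); apply: (addIr (der_fun (row_der a) f)).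
by rewrite a0 ab b0.
Qed.

Lemma pi_map_iso : module_iso (@pi_map k n f).
Proof.
split=> [c x y|]; first by apply/val_inj; rewrite /= linearP.
apply: inj_surj_bij => [[a az] [b bz] /(congr1 val) /= ab|[D Dlog]].
  by apply/val_inj/row_der_inj.
have /asboolP[h Dh] := Dlog.
(* Since D(f) = f h, the entry [- h] at [ord0] makes the row a cycle. *)
pose a : 'rV[S]_n.+1 :=
  \row_i (if unlift ord0 i is Some j then der_fun D 'X_j else - h).
have aD : row_der a = D.
  by apply: der_fun_ext => i; rewrite row_derX mxE liftK.
have az : a \in cycles1 g.
  by rewrite cycles1_jacobianE aD Dh mxE unlift_none mulNr mulrC addNr.
by exists (Submod az); apply/val_inj.
Qed.

Lemma row_der_koszul c :
  row_der (koszul_d2 g c) \in span_pred (koszul_der f).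
Proof.
rewrite linear_sum rpred_sum // => i _; rewrite linear_sum rpred_sum // => j ij.
rewrite linearZ rpredZ //= row_derZB.
(* The larger index [j] cannot be [ord0], so only [i] can point to the generator [f]. *)
case: (unliftP ord0 j) ij => [j' ->|-> //] _.
rewrite row_der_delta /jacobian_seq liftK; case: (unliftP ord0 i) => [i'|] ->.
  by rewrite row_der_delta; apply: mem_span; left; exists i', j'.
rewrite row_der_delta0 scaler0 subr0.
by apply: mem_span; right; exists j'.
Qed.

Lemma koszul_der_boundary D :
  koszul_der f D -> exists2 b, b \in boundaries1 g & row_der b = D.
Proof.
have gS i : g (lift ord0 i) = f^`M(i) by rewrite /jacobian_seq liftK.
have g0 : g ord0 = f by rewrite /jacobian_seq unlift_none.
case=> [[i [j ->]]|[i ->]].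
  exists (g (lift ord0 i) *: delta_mx 0 (lift ord0 j) -
          g (lift ord0 j) *: delta_mx 0 (lift ord0 i)).
    exact: koszul_boundary.
  by rewrite row_derZB !row_der_delta !gS.
(* The subtracted term lies along [delta_mx 0 ord0], which [row_der] kills; only [f *: partial i]
   survives. *)
exists (g ord0 *: delta_mx 0 (lift ord0 i) -
        g (lift ord0 i) *: delta_mx 0 ord0); first exact: koszul_boundary.
by rewrite row_derZB row_der_delta row_der_delta0 scaler0 subr0 g0.
Qed.

(** This is the preimage condition of [quot_module_iso]. From left to right, lifting the generators
    one by one yields a boundary [b] with the same image as [a]; both are cycles, so injectivity
    gives [b = a]. *)
Lemma row_der_span (a : 'rV[S]_n.+1) : a \in cycles1 g ->
  (row_der a \in span_pred (koszul_der f)) = (a \in boundaries1 g).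
Proof.
move=> az; apply/idP/idP => [/asboolP[s [sK as_]]|/asboolP[c ->]]; last first.
  exact: row_der_koszul.
have [b bB ab] : exists2 b, b \in boundaries1 g & row_der b = row_der a.
  rewrite as_; elim: s sK {as_} => [_|p s IH sK].
    by exists 0; rewrite ?rpred0 // linear0 big_nil.
  have [|b bB bs] := IH; first by move=> q qs; apply: sK; rewrite inE qs orbT.
  have [|d dB dp] := @koszul_der_boundary p.2.
    by apply: sK; rewrite mem_head.
  exists (p.1 *: d + b); first by rewrite rpredD ?rpredZ.
  by rewrite row_der_linear dp bs big_cons.
by rewrite -(row_der_inj _ _ (boundaries1_cycles1 bB) az ab).
Qed.

End LogarithmicDerivations.

Theorem lemma4p1 (k : fieldType) (char0 : [pchar k] =i pred0)
    (n : nat) (n_ge2 : (2 <= n)%N) (f : {mpoly k[n]}) (f_neq0 : f != 0) :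
  module_iso (@pi_map k n f) /\
  (exists phi : Hf f -> essential_der f,
     (forall z : Zf f, phi (class_H z) = pi_bar z) /\ module_iso phi).
Proof.
have pi_iso := @pi_map_iso k n f f_neq0; split=> //.
(* Membership in the restricted submodules unfolds to membership of the underlying derivation and
   row. *)
by apply: quot_module_iso => // -[a az]; apply: row_der_span.
Qed.
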